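(* Let $G$ be a countable group and let $K$ be a field. Then the group algebra $K[G]$ is one-sided Noetherian if and only if $G$ is of $K$-linear Markov type.
   Context: For a finite-dimensional $K$-vector space $A$, $A^G$ is the $K$-vector space of all maps $x \colon G \to A$, equipped with the prodiscrete topology (product topology with each factor $A$ discrete) and with the shift action of $G$ given by $(gx)(h) = x(g^{-1}h)$. A linear subshift of $A^G$ is a closed $G$-invariant vector subspace of $A^G$. A subset $\Sigma \subset A^G$ is a subshift of finite type (SFT) if there exist a finite subset $D \subset G$ and a subset $P \subset A^D$ such that $\Sigma = \{x \in A^G : (g^{-1}x)|_D \in P \text{ for all } g \in G\}$. The group $G$ is of $K$-linear Markov type if, for every finite-dimensional vector space $A$ over $K$, every linear subshift $\Sigma \subset A^G$ is an SFT. The algebra $K[G]$ is isomorphic to its opposite algebra (via $\alpha^*(g) = \alpha(g^{-1})$), so it is left Noetherian if and only if it is right Noetherian; in that case it is called one-sided Noetherian. *)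

(* Defs.v *)
From HB Require Import structures.
From mathcomp Require Import all_boot all_algebra finmap.
From mathcomp.multinomials Require Import monalg.
From mathcomp Require Import boolp classical_sets functions cardinality.
From mathcomp Require Import topology_structure function_spaces.
From mathcomp Require Import discrete_topology.

Set Implicit Arguments.
Unset Strict Implicit.
Unset Printing Implicit Defensive.

Import GRing.Theory.

Local Open Scope fset_scope.
Local Open Scope classical_set_scope.
Local Open Scope ring_scope.

(* The library's convolution product on {malg K[G]} requires a monoid with no
   nontrivial units, hence excludes groups: only its K-module structure is
   reused, through an alias that carries the group algebra product. *)
Definition group_algebra (K : fieldType) (G : groupType) : Type := {malg K[G]}.

Section GroupAlgebra.
Variables (K : fieldType) (G : groupType).

HB.instance Definition _ := GRing.Lmodule.copy (group_algebra K G) {malg K[G]}.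

Implicit Types a b c : {malg K[G]}.

Definition ga_one : {malg K[G]} := << 1 *g 1%g >>.

Definition ga_mul a b : {malg K[G]} :=
  \sum_(g <- msupp a) \sum_(h <- msupp b) << a@_g * b@_h *g (g * h)%g >>.

Lemma ga_mulw (d1 d2 : {fset G}) a b :
  (msupp a `<=` d1)%fset -> (msupp b `<=` d2)%fset ->
  ga_mul a b = \sum_(g <- d1) \sum_(h <- d2) << a@_g * b@_h *g (g * h)%g >>.
Proof.
move=> le_d1 le_d2; rewrite /ga_mul (big_fset_incl _ le_d1) /=.
  apply/eq_bigr=> g _; apply/big_fset_incl => // h _ /mcoeff_outdom ->.
  by rewrite mulr0 monalgU0.
move=> g _ /mcoeff_outdom ag.
by rewrite big1 => // h _; rewrite ag mul0r monalgU0.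
Qed.

Lemma ga_mul0l : left_zero 0 ga_mul.
Proof. by move=> a; rewrite /ga_mul msupp0 big_seq_fset0. Qed.

Lemma ga_mul0r : right_zero 0 ga_mul.
Proof.
by move=> a; rewrite /ga_mul big1 // => g _; rewrite msupp0 big_seq_fset0.
Qed.

Lemma ga_mulDl : left_distributive ga_mul +%R.
Proof.
move=> a b c.
rewrite (ga_mulw (msuppD_le a b) (fsubset_refl _)).
rewrite (ga_mulw (fsubsetUl (msupp a) (msupp b)) (fsubset_refl (msupp c))).
rewrite (ga_mulw (fsubsetUr (msupp a) (msupp b)) (fsubset_refl (msupp c))).
rewrite -big_split /=; apply/eq_bigr=> g _.
rewrite -big_split /=; apply/eq_bigr=> h _.
by rewrite mcoeffD mulrDl monalgUD.
Qed.

Lemma ga_mulDr : right_distributive ga_mul +%R.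
Proof.
move=> a b c.
rewrite (ga_mulw (fsubset_refl _) (msuppD_le b c)).
rewrite (ga_mulw (fsubset_refl (msupp a)) (fsubsetUl (msupp b) (msupp c))).
rewrite (ga_mulw (fsubset_refl (msupp a)) (fsubsetUr (msupp b) (msupp c))).
rewrite -big_split /=; apply/eq_bigr=> g _.
rewrite -big_split /=; apply/eq_bigr=> h _.
by rewrite mcoeffD mulrDr monalgUD.
Qed.

Lemma ga_mulUU (x y : K) (g h : G) :
  ga_mul << x *g g >> << y *g h >> = << x * y *g (g * h)%g >>.
Proof. by rewrite (ga_mulw msuppU_le msuppU_le) !big_seq_fset1 !mcoeffUU. Qed.

Lemma ga_mul_suml (I : Type) (r : seq I) (F : I -> {malg K[G]}) b :
  ga_mul (\sum_(i <- r) F i) b = \sum_(i <- r) ga_mul (F i) b.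
Proof.
exact: (big_morph (ga_mul^~ b) (fun _ _ => ga_mulDl _ _ _) (ga_mul0l b)).
Qed.

Lemma ga_mul_sumr (I : Type) (r : seq I) (F : I -> {malg K[G]}) a :
  ga_mul a (\sum_(i <- r) F i) = \sum_(i <- r) ga_mul a (F i).
Proof.
exact: (big_morph (ga_mul a) (fun _ _ => ga_mulDr _ _ _) (ga_mul0r a)).
Qed.

Lemma ga_mul1l : left_id ga_one ga_mul.
Proof.
move=> a; rewrite [in LHS](monalgE a) ga_mul_sumr [RHS]monalgE.
by apply: eq_bigr => g _; rewrite ga_mulUU mul1r mul1g.
Qed.

Lemma ga_mul1r : right_id ga_one ga_mul.
Proof.
move=> a; rewrite [in LHS](monalgE a) ga_mul_suml [RHS]monalgE.
by apply: eq_bigr => g _; rewrite ga_mulUU mulr1 mulg1.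
Qed.

Lemma ga_mulA : associative ga_mul.
Proof.
move=> a b c; rewrite (monalgE a) !ga_mul_suml; apply: eq_bigr => g _.
rewrite (monalgE b) ga_mul_suml !ga_mul_sumr ga_mul_suml.
apply: eq_bigr => h _.
rewrite (monalgE c) !ga_mul_sumr; apply: eq_bigr => k _.
by rewrite !ga_mulUU mulrA mulgA.
Qed.

Lemma ga_one_neq0 : ga_one != 0.
Proof. by apply/eqP/malgP=> /(_ 1%g) /eqP; rewrite !mcoeffsE oner_eq0. Qed.

Lemma ga_mulCl (x : K) a : ga_mul << x *g 1%g >> a = x *: a.
Proof.
apply/malgP => h; rewrite mcoeffZ [in LHS](monalgE a) ga_mul_sumr.
rewrite [in RHS](monalgE a) !raddf_sum /= mulr_sumr.
by apply: eq_bigr => g _; rewrite ga_mulUU mul1g !mcoeffU mulrnAr.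
Qed.

Lemma ga_mulCr (x : K) a : ga_mul a << x *g 1%g >> = x *: a.
Proof.
rewrite -ga_mulCl (monalgE a) ga_mul_suml ga_mul_sumr.
by apply: eq_bigr => g _; rewrite !ga_mulUU mul1g mulg1 mulrC.
Qed.

Lemma ga_scaleAl (x : K) a b : x *: ga_mul a b = ga_mul (x *: a) b.
Proof. by rewrite -!ga_mulCl ga_mulA. Qed.

Lemma ga_scaleAr (x : K) a b : x *: ga_mul a b = ga_mul a (x *: b).
Proof. by rewrite -!ga_mulCr ga_mulA. Qed.

HB.instance Definition _ := GRing.Zmodule_isNzRing.Build (group_algebra K G)
  ga_mulA ga_mul1l ga_mul1r ga_mulDl ga_mulDr ga_one_neq0.

HB.instance Definition _ :=
  GRing.Lmodule_isLalgebra.Build K (group_algebra K G) ga_scaleAl.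

HB.instance Definition _ :=
  GRing.Lalgebra_isAlgebra.Build K (group_algebra K G) ga_scaleAr.

End GroupAlgebra.

Section Noetherian.
Variable R : nzRingType.

Definition left_ideal (I : set R) : Prop :=
  [/\ I 0, forall x y, I x -> I y -> I (x + y) & forall r x, I x -> I (r * x)].

Definition right_ideal (I : set R) : Prop :=
  [/\ I 0, forall x y, I x -> I y -> I (x + y) & forall r x, I x -> I (x * r)].

Definition ascending_chain_condition (ideal : set R -> Prop) : Prop :=
  forall I : nat -> set R, (forall n, ideal (I n)) ->
    (forall n, I n `<=` I n.+1) ->
    exists n, forall m, (n <= m)%N -> I m = I n.

Definition left_noetherian : Prop := ascending_chain_condition left_ideal.

Definition right_noetherian : Prop := ascending_chain_condition right_ideal.

(* For group algebras the two disjuncts are equivalent, see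
   group_algebra_left_right_noetherian. *)
Definition one_sided_noetherian : Prop := left_noetherian \/ right_noetherian.

End Noetherian.

Section Opposite.
Variables (K : fieldType) (G : groupType).

Definition ga_star (a : group_algebra K G) : group_algebra K G :=
  \sum_(g <- msupp a) << (a : {malg K[G]})@_g *g g^-1%g >>.

Lemma ga_starE (a : group_algebra K G) (g : G) :
  mcoeff g (ga_star a) = mcoeff g^-1%g a.
Proof.
rewrite /ga_star raddf_sum /= [in RHS](monalgE a) raddf_sum /=.
apply: eq_bigr => h _; rewrite !mcoeffU; congr (_ *+ nat_of_bool _).
by apply/eqP/eqP => [<-|->]; rewrite invgK.
Qed.

Lemma ga_starD : {morph ga_star : a b / a + b}.
Proof.
by move=> a b; apply/malgP => g; rewrite mcoeffD !ga_starE mcoeffD.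
Qed.

Lemma ga_star0 : ga_star 0 = 0.
Proof. by apply/malgP => g; rewrite ga_starE !mcoeff0. Qed.

Lemma ga_starK : involutive ga_star.
Proof. by move=> a; apply/malgP => g; rewrite !ga_starE invgK. Qed.

Lemma ga_starU (x : K) (g : G) :
  ga_star (<< x *g g >> : {malg K[G]}) = << x *g g^-1%g >>.
Proof.
apply/malgP => h; rewrite ga_starE !mcoeffU; congr (_ *+ nat_of_bool _).
by apply/eqP/eqP => [->|<-]; rewrite invgK.
Qed.

Lemma ga_star_sum (I : Type) (r : seq I) (F : I -> {malg K[G]}) :
  ga_star (\sum_(i <- r) F i) = \sum_(i <- r) (ga_star (F i) : {malg K[G]}).
Proof. exact: (big_morph ga_star ga_starD ga_star0). Qed.

Lemma ga_starM (a b : group_algebra K G) :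
  ga_star (a * b) = ga_star b * ga_star a.
Proof.
change (ga_star (ga_mul a b) = ga_mul (ga_star b) (ga_star a)).
rewrite (monalgE a) !(ga_mul_suml, ga_star_sum, ga_mul_sumr).
apply: eq_bigr => g _.
rewrite (monalgE b) !(ga_mul_sumr, ga_star_sum, ga_mul_suml).
apply: eq_bigr => h _.
by rewrite ga_mulUU !ga_starU ga_mulUU mulrC invgM.
Qed.

Let star_preim (I : set (group_algebra K G)) := ga_star @^-1` I.

Let star_preimK : involutive star_preim.
Proof. by move=> I; apply/seteqP; split=> a; rewrite /star_preim /= ga_starK. Qed.

Lemma acc_transfer (id1 id2 : set (group_algebra K G) -> Prop) :
  (forall I, id2 I -> id1 (star_preim I)) ->
  ascending_chain_condition id1 -> ascending_chain_condition id2.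
Proof.
move=> id21 acc I idI incI.
have [n nP] := acc (fun n => star_preim (I n)) (fun n => id21 _ (idI n))
  (fun n a => incI n (ga_star a)).
exists n => m /nP eqI.
by rewrite -[LHS]star_preimK eqI star_preimK.
Qed.

Lemma group_algebra_left_right_noetherian :
  left_noetherian (group_algebra K G) <-> right_noetherian (group_algebra K G).
Proof.
split; apply: acc_transfer => I [I0 ID IM]; split; rewrite /star_preim /=.
- by rewrite ga_star0.
- by move=> a b Ia Ib; rewrite ga_starD; apply: ID.
- by move=> r a Ia; rewrite ga_starM; apply: IM.
- by rewrite ga_star0.
- by move=> a b Ia Ib; rewrite ga_starD; apply: ID.
- by move=> r a Ia; rewrite ga_starM; apply: IM.
Qed.

End Opposite.

Section Subshifts.
Variables (K : fieldType) (G : groupType) (A : vectType K).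

Definition shift (g : G) (x : G -> A) : G -> A := fun h => x (g^-1 * h)%g.

Definition prodiscrete_closed (S : set (G -> A)) : Prop :=
  closed (S : set {ptws G -> discrete_topology A}).

Definition linear_subshift (S : set (G -> A)) : Prop :=
  [/\ prodiscrete_closed S,
      forall g x, S x -> S (shift g x),
      S 0,
      forall x y, S x -> S y -> S (x + y)
    & forall (c : K) x, S x -> S (c *: x)].

Definition is_sft (S : set (G -> A)) : Prop :=
  exists (D : {fset G}) (P : set (D -> A)),
    S = [set x | forall g : G, P (fun d : D => shift g^-1%g x (val d))].

End Subshifts.

Definition linear_markov_type (K : fieldType) (G : groupType) : Prop :=
  forall (A : vectType K) (S : set (G -> A)), linear_subshift S -> is_sft S.

(* Main.v *)
(** A finitely supported a in K[G] pairs with x in K^G by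
    <a, x> = sum_g a(g) x(g), and <g a, x> = <a, g^-1 x>; hence orthogonality
    relates left submodules of K[G]^n to linear subshifts of (K^n)^G.

    If K[G] is left Noetherian, the orthogonal of a linear subshift S is
    generated by finitely many elements, whose supports lie in a finite D; as S
    is closed, it is the orthogonal of its orthogonal, so S is defined by its
    restriction to D.

    Conversely, let I be the union of an ascending chain of left ideals I_n. If
    the orthogonal of I is an SFT defined on D, then it is already the
    orthogonal of the left ideal generated by the elements of I supported in D.
    These form a finite-dimensional space, hence lie in some I_n, and taking
    orthogonals again gives I = I_n. Since a functional on K[G] is the same as
    an element of K^G, the biorthogonal of a left ideal is itself. *)

Require Import Defs.
From HB Require Import structures.
From mathcomp Require Import all_boot all_algebra finmap.
From mathcomp.multinomials Require Import monalg.
From mathcomp Require Import boolp classical_sets functions cardinality.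
From mathcomp Require Import topology_structure function_spaces.
From mathcomp Require Import discrete_topology supremum_topology filter.

Set Implicit Arguments.
Unset Strict Implicit.
Unset Printing Implicit Defensive.

Import GRing.Theory.

Local Open Scope fset_scope.
Local Open Scope classical_set_scope.
Local Open Scope ring_scope.

(** * Submodules, finite generation and separating functionals *)

Definition submodule (R : nzRingType) (U : lmodType R) (N : set U) : Prop :=
  [/\ N 0, forall u v, N u -> N v -> N (u + v) & forall r u, N u -> N (r *: u)].

(** Generation is expressed by minimality among submodules, so that no linear combinations need to
    be written. *)
Definition finitely_generated (R : nzRingType) (U : lmodType R) (N : set U) :=
  exists s : seq U, {in s, forall u, N u} /\
    forall J, submodule J -> {in s, forall u, J u} -> N `<=` J.

Lemma submoduleB (R : nzRingType) (U : lmodType R) (N : set U) u v :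
  submodule N -> N u -> N v -> N (u - v).
Proof.
by case=> _ ND NZ Nu Nv; rewrite -scaleN1r; apply: ND => //; apply: NZ.
Qed.

(* A maximal subspace containing W and avoiding v is a hyperplane, and
   V = H + K v defines the functional. *)
Lemma separating_functional (K : fieldType) (V : lmodType K) (W : set V) v :
  submodule W -> ~ W v ->
  exists phi : {scalar V}, (forall w, W w -> phi w = 0) /\ phi v = 1.
Proof.
move=> subW Wv.
pose P (H : set V) := H = set0 \/ [/\ submodule H, W `<=` H & ~ H v].
have [|H [PH maxH]] := @Zorn_bigcup V P.
  move=> F FP Ftot.
  have [[X [FX X0]]|F0] := pselect (exists X, F X /\ X !=set0).
    have FP' Y y : F Y -> Y y -> [/\ submodule Y, W `<=` Y & ~ Y v].
      by move=> FY Yy; case: (FP _ FY) => // Y0; rewrite Y0 in Yy.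
    right; case: X0 => x Xx; have [[X0 _ _] WX _] := FP' _ _ FX Xx.
    split; last by case=> Y FY Yv; case: (FP' _ _ FY Yv).
    - split; first by exists X.
      + move=> a b [Y FY Ya] [Z FZ Zb].
        have [YZ|ZY] := Ftot _ _ FY FZ.
          exists Z => //; have [[_ ZD _] _ _] := FP' _ _ FZ Zb.
          by apply: ZD => //; exact: YZ.
        exists Y => //; have [[_ YD _] _ _] := FP' _ _ FY Ya.
        by apply: YD => //; exact: ZY.
      + move=> r a [Y FY Ya]; exists Y => //.
        by have [[_ _ YZ] _ _] := FP' _ _ FY Ya; apply: YZ.
    - by move=> w /WX Xw; exists X.
  left; rewrite -subset0 => x [Y FY Yx]; apply: F0; exists Y; split => //.
  by exists x.
have {PH} [subH WH Hv] : [/\ submodule H, W `<=` H & ~ H v].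
  case: PH => // H0; have W0 : W 0 by case: subW.
  have ltHW : H `<` W by rewrite H0; split=> // /(_ _ W0).
  by case: (maxH _ ltHW); right; split.
have [H0 HD HZ] := subH.
have dec u : exists c, H (u - c *: v).
  have [Hu|nHu] := pselect (H u); first by exists 0; rewrite scale0r subr0.
  (* [H'] is [H + K u]. By maximality it contains [v], and the coefficient of [u] is nonzero as [v]
     is not in [H]; dividing by it expresses [u] modulo [H] as a multiple of [v]. *)
  pose H' := [set w | exists a, H (w - a *: u)].
  have subH' : submodule H'.
    split; first by exists 0; rewrite scale0r subr0.
      move=> x y [a Ha] [b Hb]; exists (a + b).
      by rewrite scalerDl opprD addrACA; apply: HD.
    by move=> r x [a Ha]; exists (r * a); rewrite -scalerA -scalerBr; apply: HZ.
  have HH' : H `<=` H' by move=> w Hw; exists 0; rewrite scale0r subr0.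
  have H'u : H' u by exists 1; rewrite scale1r subrr.
  have [[a Ha]|nH'v] := pselect (H' v); last first.
    exfalso; apply: (maxH H'); first by split=> // /(_ _ H'u).
    by right; split=> // w /WH /HH'.
  have a0 : a != 0.
    by apply/eqP => a0; apply: Hv; rewrite a0 scale0r subr0 in Ha.
  exists a^-1; have /(HZ (- a^-1)) := Ha.
  by rewrite scalerBr scalerA mulNr mulVf // scaleN1r opprK scaleNr addrC.
have uniq_dec u c d : H (u - c *: v) -> H (u - d *: v) -> c = d.
  move=> Hc Hd; have := submoduleB subH Hd Hc.
  rewrite opprB addrC addrA subrK -scalerBl => /(HZ (c - d)^-1).
  case: (eqVneq c d) => // cd; rewrite scalerA mulVf ?subr_eq0 // scale1r.
  by move/Hv.
have [f fP] := choice dec.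
have flin : linear_for *%R f.
  move=> a x y; apply: (uniq_dec (a *: x + y)); first exact: fP.
  rewrite scalerDl opprD addrACA -scalerA -scalerBr.
  by apply: HD; [apply: HZ|]; apply: fP.
pose L := GRing.isLinear.Build K V K *%R f flin.
pose phi : {scalar V} := HB.pack f L.
exists phi; split=> [w Ww|].
  by apply: (uniq_dec w); [exact: fP | rewrite scale0r subr0; exact: WH].
by apply: (uniq_dec v); [exact: fP | rewrite scale1r subrr].
Qed.

(** Otherwise elements of [I] can be chosen one after another, each outside the span of the earlier
    ones, and these spans never stabilise. *)
Lemma left_noetherian_finitely_generated (R : nzRingType) (I : set R^o) :
  left_noetherian R -> submodule I -> finitely_generated I.
Proof.
move=> noeth subI; apply: contrapT => nfg.
pose span (s : seq R) :=
  [set x : R | forall J : set R^o, submodule J -> {in s, forall u, J u} -> J x].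
have step (s : seq R) : exists x, {in s, forall u, I u} -> I x /\ ~ span s x.
  have [Is|] := pselect {in s, forall u, I u}; last by exists 0.
  apply: contrapT => /forallNP all_in; apply: nfg.
  exists s; split=> // J subJ Js x Ix.
  have /not_implyP[_ /not_andP[//|/contrapT xs]] := all_in x.
  exact: xs.
have [next nextP] := choice step.
pose s := fix s n := if n is m.+1 then next (s m) :: s m else [::].
have sI n : {in s n, forall u, I u}.
  elim: n => //= n IHn u; rewrite inE => /orP[/eqP->|/IHn //].
  by case: (nextP _ IHn).
have ideal_span n : left_ideal (span (s n)).
  split=> [J [] // | x y sx sy J subJ Js | r x sx J subJ Js].
    by case: (subJ) => _ JD _; apply: JD; [exact: sx | exact: sy].
  by case: (subJ) => _ _ JZ; apply: JZ; exact: sx.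
have incr_span n : span (s n) `<=` span (s n.+1).
  move=> x sx J subJ Js; apply: sx => // u us; apply: Js.
  by rewrite inE us orbT.
have [n nP] := noeth _ ideal_span incr_span.
case: (nextP _ (sI n)) => _; apply; rewrite -(nP n.+1) //.
by move=> J _; apply; rewrite inE eqxx.
Qed.

Lemma field_finitely_generated (K : fieldType) (I : set K^o) :
  submodule I -> finitely_generated I.
Proof.
move=> [I0 _ _]; have [[x [Ix x0]]|] := pselect (exists x, I x /\ x != 0).
  exists [:: x]; split=> [u|J [_ _ JZ] Jx y _]; first by rewrite inE => /eqP->.
  rewrite -[y](mulfVK x0); apply: (JZ (y / x)); apply: Jx.
  by rewrite inE.
move=> nI; exists [::]; split=> // J [J0 _ _] _ y Iy.
by have [->//|y0] := eqVneq y 0; case: nI; exists y.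
Qed.

(* By induction on ts: N is an extension of the left ideal p i @` N by the part
   of N on which p i vanishes. *)
Lemma finitely_generated_coords (R : nzRingType) (U : lmodType R) (T : eqType)
    (p : T -> U -> R) (ts : seq T) (N : set U) :
  (forall I : set R^o, submodule I -> finitely_generated I) ->
  (forall i, linear (p i : U -> R^o)) -> submodule N ->
  (forall u, N u -> {in ts, forall i, p i u = 0} -> u = 0) ->
  finitely_generated N.
Proof.
move=> fgR plin subN N0.
(* Generalised for the induction: if the coordinates in [ts] need not separate points, [s] generates
   [N] up to elements on which they all vanish. *)
suff [s [sN sP]] : exists s : seq U, {in s, forall u, N u} /\
    forall J, submodule J -> {in s, forall u, J u} ->
    (forall u, N u -> {in ts, forall i, p i u = 0} -> J u) -> N `<=` J.
  exists s; split=> // J subJ Js; apply: sP => // u Nu /N0 ->//.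
  by case: subJ.
move: N subN {N0}; elim: ts => [|i ts IH] N subN.
  by exists [::]; split=> // J subJ _ NJ u Nu; apply: NJ.
have [N0 ND NZ] := subN.
have pD u v : p i (u + v) = p i u + p i v.
  by have := plin i 1 u v; rewrite !scale1r.
have p0 : p i 0 = 0 by apply: (addrI (p i 0)); rewrite -pD !addr0.
have pZ r u : p i (r *: u) = r * p i u.
  by have := plin i r u 0; rewrite p0 !addr0.
have pB u v : p i (u - v) = p i u - p i v.
  by rewrite pD -scaleN1r pZ mulN1r.
have [|s' [s'N s'P]] := IH [set u | N u /\ p i u = 0].
  split=> [|u v [Nu pu] [Nv pv]|r u [Nu pu]] //=.
    by split; [exact: ND | rewrite pD pu pv addr0].
  by split; [exact: NZ | rewrite pZ pu mulr0].
have image_ideal (M : set U) : submodule M ->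
    submodule ([set r | exists2 u, M u & p i u = r] : set R^o).
  move=> [M0 MD MZ]; split; first by exists 0.
    move=> _ _ [u Mu <-] [v Mv <-]; exists (u + v) => //; exact: MD.
  by move=> r _ [u Mu <-]; exists (r *: u) => //; exact: MZ.
have [s0 [s0N s0P]] := fgR _ (image_ideal _ subN).
have lift r : exists u, r \in s0 -> N u /\ p i u = r.
  have [/s0N[u Nu pu]|//] := boolP (r \in s0); first by exists u.
  by exists 0.
have [l lP] := choice lift.
exists (map l s0 ++ s'); split=> [u|J subJ Js NJ u Nu].
  by rewrite mem_cat => /orP[/mapP[r rs ->]|/s'N[]//]; case: (lP _ rs).
have N'J : [set u | N u /\ p i u = 0] `<=` J.
  apply: s'P => // [v vs|v [Nv pv] zv].
    by apply: Js; rewrite mem_cat vs orbT.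
  by apply: NJ => // j; rewrite inE => /orP[/eqP->|/zv].
have [J0 JD JZ] := subJ.
have subNJ : submodule (N `&` J).
  split=> // [v w [Nv Jv] [Nw Jw]|r v [Nv Jv]].
    by split; [exact: ND | exact: JD].
  by split; [exact: NZ | exact: JZ].
have [||w [Nw Jw] pw] := s0P _ (image_ideal _ subNJ) _ (p i u).
- move=> r rs; have [Nl pl] := lP _ rs; exists (l r) => //; split=> //.
  by apply: Js; rewrite mem_cat map_f.
- by exists u.
rewrite -[u](subrK w); apply: JD => //; apply: N'J.
by split; [exact: submoduleB | rewrite pB pw subrr].
Qed.

(** * Closed sets of the prodiscrete topology, through cylinders *)

Lemma prodiscrete_closedP (K : fieldType) (G : groupType) (A : vectType K)
    (S : set (G -> A)) :
  prodiscrete_closed S <->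
  forall x, (forall E : {fset G}, exists2 y, S y & {in E, y =1 x}) -> S x.
Proof.
pose T : topologicalType := {ptws G -> discrete_topology A}.
have cylinder (x : G -> A) (E : {fset G}) :
    nbhs (x : T) [set y : G -> A | {in E, y =1 x}].
  have -> : [set y : G -> A | {in E, y =1 x}] =
      \bigcap_(g in [set` E]) [set y | y g = x g].
    by apply/seteqP; split=> y; [move=> yx g /yx | move=> yx g /yx].
  apply: filter_bigI => g _.
  have := @proj_continuous G (fun _ => discrete_topology A) g x.
  by move=> /(_ [set x g] (discrete_set1 _)).
split=> [clS x Sx | Scyl x clx]; last first.
  by apply: Scyl => E; have [y [Sy yx]] := clx _ (cylinder x E); exists y.
pose F := filter_from [set: {fset G}] (fun E => [set y : T | {in E, y =1 x}]).
have FF : Filter F.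
  apply: filter_from_filter; first by exists fset0.
  move=> D E _ _; exists (D `|` E)%fset => // y yx.
  by split=> g gE; apply: yx; rewrite inE gE ?orbT.
(* Convergence in the product is checked at each [g] separately, where the cylinder over [[fset g]]
   suffices. *)
have Fx : F --> (x : T).
  apply/cvg_sup => g B /= [C [[D _ <-] Dx] DB].
  exists [fset g] => // y yx; apply: DB; rewrite /= yx ?inE //.
apply: clS => B /Fx [E _ EB].
by have [y Sy yx] := Sx E; exists y; split=> //; apply: EB.
Qed.

(** * The pairing of K[G] with K^G *)

Definition pairing (K : fieldType) (G : groupType) (a : {malg K[G]})
    (x : G -> K) : K :=
  mmap idfun x a.

Lemma eq_pairing (K : fieldType) (G : groupType) (a : {malg K[G]})
    (x y : G -> K) :
  {in msupp a, x =1 y} -> pairing a x = pairing a y.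
Proof. by move=> xy; apply: eq_big_seq => g /xy ->. Qed.

Lemma pairingDl (K : fieldType) (G : groupType) (a b : {malg K[G]})
    (x : G -> K) :
  pairing (a + b) x = pairing a x + pairing b x.
Proof. exact: raddfD. Qed.

Lemma pairingZl (K : fieldType) (G : groupType) (c : K) (a : {malg K[G]})
    (x : G -> K) :
  pairing (c *: a) x = c * pairing a x.
Proof.
rewrite /pairing (mmapEw (msuppZ_le _ _)) mmapE mulr_sumr.
by apply: eq_bigr => g _; rewrite mcoeffZ mulrA.
Qed.

Lemma pairingDr (K : fieldType) (G : groupType) (a : {malg K[G]})
    (x y : G -> K) :
  pairing a (x + y) = pairing a x + pairing a y.
Proof. by rewrite -big_split; apply: eq_bigr => g _; rewrite mulrDr. Qed.

Lemma pairingZr (K : fieldType) (G : groupType) (a : {malg K[G]}) (c : K)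
    (x : G -> K^o) :
  pairing a (c *: x) = c * pairing a x.
Proof. by rewrite mulr_sumr; apply: eq_bigr => g _; rewrite mulrCA. Qed.

(** Expanding [a] over its support reduces this to <g b, x> = <b, g^-1 x>. *)
Lemma pairing_mul (K : fieldType) (G : groupType) (a b : group_algebra K G)
    (x : G -> K^o) :
  pairing (a * b) x =
  \sum_(g <- msupp a) mcoeff g a * pairing b (shift g^-1%g x).
Proof.
rewrite -[a * b]/(ga_mul a b) /ga_mul /pairing raddf_sum.
apply: eq_bigr => g _; rewrite raddf_sum mulr_sumr /=.
by apply: eq_bigr => h _; rewrite mmapU /shift invgK mulrA.
Qed.

(** The group elements form a basis of K[G], which identifies its dual with K^G. *)
Lemma scalar_pairing (K : fieldType) (G : groupType)
    (phi : {scalar {malg K[G]}}) (a : {malg K[G]}) :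
  phi a = pairing a (fun g => phi << 1 *g g >>).
Proof.
rewrite [in LHS](monalgE a) linear_sum; apply: eq_bigr => g _ /=.
rewrite -linearZ /=; congr (phi _); apply/malgP => h.
by rewrite mcoeffZ !mcoeffU mulrnAr mulr1.
Qed.

(** The difference between [y] and the sum of its one-point pieces over [D] vanishes on [D]. This
    turns functionals that only see [D] into elements supported in [D]. *)
Lemma scalar_local (K : fieldType) (G : groupType) (A : vectType K)
    (psi : {scalar (G -> A)}) (D : {fset G}) :
  (forall y, {in D, forall g, y g = 0} -> psi y = 0) ->
  forall y, psi y =
    \sum_(d <- D) psi (fun g => if g == d then y d else 0).
Proof.
move=> psiD y; apply/eqP; rewrite -linear_sum -subr_eq0 -linearB; apply/eqP.
apply: psiD => g gD.
rewrite /GRing.add /GRing.opp /= fct_sumE (bigD1_seq g) ?fset_uniq //= eqxx.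
rewrite big1 ?addr0 ?subrr // => d dg.
by rewrite eq_sym (negbTE dg).
Qed.

(** * From the Noetherian property to finite type *)

Lemma noetherian_linear_markov (K : fieldType) (G : groupType) :
  left_noetherian (group_algebra K G) -> linear_markov_type K G.
Proof.
move=> noeth A S [/prodiscrete_closedP clS Sshift S0 SD SZ].
set n := \dim {:A}; pose b : n.-tuple A := vbasis {:A}.
(* The basis [b] identifies A with K^n, so row vectors over K[G] pair with A^G. *)
pose pair (f : 'rV[group_algebra K G]_n) (x : G -> A) :=
  \sum_i pairing (f 0 i) (fun g => coord b i (x g)).
pose N := [set f | forall s, S s -> pair f s = 0].
have pair_scale r f x : pair (r *: f) x =
    \sum_(g <- msupp r) mcoeff g r * pair f (shift g^-1%g x).
  under [RHS]eq_bigr do rewrite mulr_sumr.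
  rewrite exchange_big; apply: eq_bigr => i _; rewrite mxE.
  exact: pairing_mul.
have subN : submodule N.
  split=> [s _|u v Nu Nv s Ss|r u Nu s Ss].
  - by rewrite /pair big1 // => i _; rewrite mxE /pairing raddf0.
  - rewrite -[0]addr0 -{1}(Nu s Ss) -(Nv s Ss) /pair -big_split.
    by apply: eq_bigr => i _; rewrite mxE pairingDl.
  - rewrite pair_scale big1 // => g _; rewrite Nu ?mulr0 //; exact: Sshift.
have [||ts [tsN tsP]] := @finitely_generated_coords _ _ _
  (fun (i : 'I_n) (f : 'rV[group_algebra K G]_n) => f 0 i) (enum 'I_n) N
  (fun I => left_noetherian_finitely_generated noeth) _ subN.
- by move=> i r u v; rewrite !mxE.
- move=> u _ u0; apply/rowP => i; rewrite mxE; apply: u0; exact: mem_enum.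
pose D := (\bigcup_(f <- ts) \bigcup_(i <- enum 'I_n) msupp (f 0 i))%fset.
exists D, [set q | exists2 s, S s & forall d : D, q d = s (val d)].
apply/seteqP; split=> [s Ss g /=|x xP].
  by exists (shift g^-1%g s) => //; exact: Sshift.
have killx f : N f -> pair f x = 0.
  move=> Nf.
  (* All translates of [x] are included: the annihilator of [x] alone need not be stable under left
     multiplication. *)
  pose J := [set f | forall g, pair f (shift g x) = 0].
  have subJ : submodule J.
    split=> [g|u v Ju Jv g|r u Ju g].
    - by rewrite /pair big1 // => i _; rewrite mxE /pairing raddf0.
    - rewrite -[0]addr0 -{1}(Ju g) -(Jv g) /pair -big_split.
      by apply: eq_bigr => i _; rewrite mxE pairingDl.
    - rewrite pair_scale big1 // => h _.
      have -> : shift h^-1%g (shift g x) = shift (h^-1 * g)%g x.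
        by apply/funext => k; rewrite /shift invgM mulgA.
      by rewrite Ju mulr0.
  suff Jf : J f.
    rewrite -(Jf 1%g); congr (pair f _); apply/funext => g.
    by rewrite /shift invg1 mul1g.
  apply: (tsP J subJ) => // t tts g; have [s Ss sx] := xP g^-1%g.
  rewrite -(tsN t tts s Ss); apply: eq_bigr => i _; apply: eq_pairing => h hs.
  have hD : h \in D.
    apply: (fsubsetP (bigfcup_sup _ tts isT)).
    exact: (fsubsetP (bigfcup_sup _ (mem_enum _ i) isT)).
  by have := sx [` hD]%fset; rewrite /= invgK => ->.
apply: contrapT => nSx.
have [E nE] : exists E : {fset G}, ~ exists2 y, S y & {in E, y =1 x}.
  by apply/existsNP => /clS.
(* [W] is S plus the maps vanishing on [E]. A functional that kills [W] but not [x] depends only on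
   the values on [E], hence is the pairing with some [f] in [N], contradicting [killx]. *)
pose W := [set y : G -> A | exists2 s, S s & {in E, y =1 s}].
have subW : submodule W.
  split; first by exists 0.
    move=> u v [s Ss us] [t St vt]; exists (s + t); first exact: SD.
    by move=> g gE; rewrite /GRing.add /= us ?vt.
  move=> r u [s Ss us]; exists (r *: s); first exact: SZ.
  by move=> g gE; rewrite /GRing.scale /= us.
have [|psi [psiW psix]] := separating_functional subW (v := x).
  by case=> s Ss xs; apply: nE; exists s => // g gE; rewrite xs.
have psiE : forall y, {in E, forall g, y g = 0} -> psi y = 0.
  by move=> y y0; apply: psiW; exists 0.
pose f : 'rV[group_algebra K G]_n := \row_i \sum_(d <- E)
  (<< psi (fun g => if g == d then b`_i else 0) *g d >> : {malg K[G]}).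
have pair_f y : pair f y = psi y.
  rewrite (scalar_local psiE y) /pair.
  under eq_bigr => i _.
    rewrite mxE /pairing raddf_sum; under eq_bigr do rewrite /= mmapU.
    over.
  rewrite exchange_big; apply: eq_bigr => d _ /=.
  have -> : (fun g => if g == d then y d else 0) =
      \sum_(i < n) coord b i (y d) *: (fun g => if g == d then b`_i else 0).
    apply/funext => g; rewrite fct_sumE /GRing.scale /=.
    case: eqP => _; last by rewrite big1 // => i _; rewrite scaler0.
    by apply: coord_vbasis; rewrite memvf.
  rewrite linear_sum; apply: eq_bigr => i _.
  by rewrite linearZ mulrC.
have /killx : N f by move=> s Ss; rewrite pair_f; apply: psiW; exists s.
by rewrite pair_f psix => /eqP; rewrite oner_eq0.
Qed.

(** * From finite type to the Noetherian property *)

Lemma linear_markov_noetherian (K : fieldType) (G : groupType) :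
  linear_markov_type K G -> left_noetherian (group_algebra K G).
Proof.
move=> markov I idI incI.
have {}incI m n : (m <= n)%N -> I m `<=` I n.
  move=> /subnK <-; elim: (n - m)%N => // k IH a /IH; exact: incI.
have idealZ n (c : K) a : I n a -> I n (c *: a).
  by case: (idI n) => _ _ IM Ia; rewrite -[a]mul1r scalerAl; exact: IM.
have subI n : submodule (I n : set {malg K[G]}).
  by case: (idI n) => I0 ID _; split=> // c a; exact: idealZ.
pose Iu : set {malg K[G]} := \bigcup_n I n.
have subIu : submodule Iu.
  split=> [|a b [m _ Ia] [n _ Ib]|c a [n _ Ia]].
  - by exists 0%N => //; case: (idI 0%N).
  - exists (maxn m n) => //; case: (idI (maxn m n)) => _ ID _.
    apply: ID; [apply: incI Ia | apply: incI Ib];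
      by rewrite ?leq_maxl ?leq_maxr.
  - by exists n => //; exact: idealZ.
pose S := [set x : G -> K^o | forall a, Iu a -> pairing a x = 0].
pose U g : group_algebra K G := (<< 1 *g g >> : {malg K[G]}).
have pairing_shift (a : group_algebra K G) g (x : G -> K^o) :
    pairing a (shift g^-1%g x) = pairing (U g * a) x.
  by rewrite pairing_mul msuppU oner_eq0 big_seq_fset1 mcoeffUU mul1r.
have subshiftS : linear_subshift S.
  split=> [|g x Sx a [n _ Ia]||x y Sx Sy a Ia|c x Sx a Ia].
  - apply/prodiscrete_closedP => x xS a Ia; have [y Sy yx] := xS (msupp a).
    by rewrite -(Sy a Ia); apply: eq_pairing => g /yx.
  - rewrite -[g]invgK pairing_shift; apply: Sx; exists n => //.
    by case: (idI n) => _ _; apply.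
  - by move=> a _; rewrite /pairing mmapE big1 // => g _; rewrite mulr0.
  - by rewrite pairingDr Sx // Sy // addr0.
  - by rewrite pairingZr Sx // mulr0.
have [D [P SP]] := markov _ _ subshiftS.
(* The coefficients at the elements of [D] are finitely many coordinates that separate these
   elements. *)
have [s [sI sP]] : finitely_generated (Iu `&` [set a | msupp a `<=` D]%fset).
  apply: (@finitely_generated_coords _ _ _ (fun g a => mcoeff g a) D).
  - exact: field_finitely_generated.
  - by move=> g c a b; rewrite mcoeffD mcoeffZ.
  - case: subIu => I0 ID IZ; split.
    + by split; rewrite //= msupp0 fsub0set.
    + move=> a b [Ia aD] [Ib bD]; split; first exact: ID.
      by apply: fsubset_trans (msuppD_le _ _) _; rewrite fsubUset; apply/andP.
    + move=> c a [Ia aD]; split; first exact: IZ.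
      exact: fsubset_trans (msuppZ_le _ _) aD.
  - move=> a [_ /= /fsubsetP aD] a0; apply/malgP => g; rewrite mcoeff0.
    by case: msuppP => // gs; rewrite a0 ?aD.
have {s sI sP} [n nP] : exists n, Iu `&` [set a | msupp a `<=` D]%fset `<=` I n.
  suff [n sn] : exists n, {in s, forall a, I n a}.
    by exists n; exact: (sP _ (subI n)).
  elim: s sI {sP} => [|a s IH] sI; first by exists 0%N.
  have [|n sn] := IH; first by move=> b bs; apply: sI; rewrite inE bs orbT.
  have [|[m _ Ia] _] := sI a; first by rewrite inE eqxx.
  exists (maxn m n) => b; rewrite inE => /orP[/eqP->|/sn Ib].
    exact: incI (leq_maxl _ _) _ Ia.
  exact: incI (leq_maxr _ _) _ Ib.
exists n => m le_nm; apply/seteqP; split; last exact: incI.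
move=> v Imv; apply: contrapT => nIv.
have Iuv : Iu v by exists m.
have [phi [phiI phiv]] := separating_functional (subI n) nIv.
(* [x] represents [phi]: it is orthogonal to [I n] but not to [v], so membership in [S] is
   absurd. *)
pose x : G -> K^o := fun g => phi << 1 *g g >>.
suff /(_ v Iuv) : S x.
  by rewrite -scalar_pairing phiv => /eqP; rewrite oner_eq0.
rewrite SP => g.
(* [P] only sees the restriction to [D], and the pattern of [y] at the identity is in [P]. *)
suff [y Sy yx] : exists2 y, S y & {in D, y =1 shift g^-1%g x}.
  move: Sy; rewrite SP => /(_ 1%g) /=; congr P; apply/funext => d.
  by rewrite -yx ?fsvalP // /shift !invg1 mul1g.
apply: contrapT => nS.
pose W := [set z : G -> K^o | exists2 y, S y & {in D, z =1 y}].
have [_ _ S0 SD SZ] := subshiftS.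
have subW : submodule W.
  split; first by exists 0.
    move=> u w [y Sy uy] [z Sz wz]; exists (y + z); first exact: SD.
    by move=> h hD; rewrite /GRing.add /= uy ?wz.
  move=> c u [y Sy uy]; exists (c *: y); first exact: SZ.
  by move=> h hD; rewrite /GRing.scale /= uy.
have [|psi [psiW psix]] := separating_functional subW (v := shift g^-1%g x).
  by case=> y Sy xy; apply: nS; exists y => // h hD; rewrite xy.
have psiD : forall y, {in D, forall h, y h = 0} -> psi y = 0.
  by move=> y y0; apply: psiW; exists 0.
(* [f] represents [psi] and is supported in [D]. *)
pose f : {malg K[G]} :=
  \sum_(d <- D) << psi (fun h => if h == d then 1 else 0) *g d >>.
have pairing_f y : pairing f y = psi y.
  rewrite (scalar_local psiD y) /pairing raddf_sum; apply: eq_bigr => d _ /=.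
  rewrite mmapU /= mulrC -linearZ; congr (psi _); apply/funext => h.
  rewrite -[LHS]/(y d * if h == d then 1 else 0).
  by case: eqP => _; rewrite ?mulr1 ?mulr0.
have fD : (msupp f `<=` D)%fset.
  apply/fsubsetP => h; rewrite -mcoeff_neq0; apply: contraR => hD.
  rewrite raddf_sum big_seq big1 // => d dD /=; rewrite mcoeffU.
  by case: eqP hD => // <-; rewrite dD.
(* Biorthogonality: a functional separating [f] from [Iu] would be a point of [S] at which [psi] is
   nonzero. *)
have If : Iu f.
  apply: contrapT => nIf.
  have [chi [chiI chif]] := separating_functional subIu nIf.
  pose z : G -> K^o := fun h => chi << 1 *g h >>.
  have Sz : S z by move=> a Ia; rewrite -scalar_pairing chiI.
  have : psi z = 0 by apply: psiW; exists z.
  by rewrite -pairing_f -scalar_pairing chif => /eqP; rewrite oner_eq0.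
have Inf : I n f by exact: nP.
(* The value of [psi] at the translate of [x] is [phi (U g * f)], which is zero since [U g * f] lies
   in [I n]. *)
move/eqP: psix; rewrite -pairing_f pairing_shift -scalar_pairing phiI.
  by rewrite eq_sym oner_eq0.
by case: (idI n) => _ _; apply.
Qed.

Theorem theorem1p3 (K : fieldType) (G : groupType)
    (countable_G : countable [set: G]%classic) :
  one_sided_noetherian (group_algebra K G) <-> linear_markov_type K G.
Proof.
split=> [[|/group_algebra_left_right_noetherian]|/linear_markov_noetherian].
- exact: noetherian_linear_markov.
- exact: noetherian_linear_markov.
- by left.
Qed.
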